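(* Let $p,q\in\mathbb{N}$ be such that $2\le q\le 2p$. Let $\beta\in\mathbb{R}$, and let $$\mathcal{I}_{p,q}(0,\beta)=\int_0^\infty\frac{(1-\cos\beta x)^p}{x^q}\,dx.$$ (a) If $q$ is even, then $$\mathcal{I}_{p,q}(0,\beta)=\frac{\pi(-1)^{q/2}|\beta|^{q-1}}{2^p(q-1)!}\sum_{k=1}^p(-1)^k\binom{2p}{p-k}k^{q-1}.$$ (b) If $q$ is odd, then $$\mathcal{I}_{p,q}(0,\beta)=\frac{(-1)^{\frac{q-1}2}|\beta|^{q-1}}{2^{p-1}(q-1)!}\sum_{k=1}^{p-1}(-1)^k\binom{2p}{p-k}k^{q-1}\log\frac pk.$$
   Context: $\mathbb{N}=\{1,2,3,\ldots\}$. The integral is an improper (Riemann) integral at both endpoints ($\lim$ of $\int_\varepsilon^R$ as $\varepsilon\to0^+$, $R\to\infty$). *)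

(* Defs.v *)
From Stdlib Require Import Reals.
From Coquelicot Require Import Coquelicot.
Open Scope R_scope.

(* Improper at both endpoints: [is_improper_RInt_0_infty f l] says that f is
   Riemann integrable on [e, T] for all e > 0 small and T large, and that these
   integrals converge to l as e -> 0+ and T -> +oo. *)
Definition is_improper_RInt_0_infty (f : R -> R) (l : R) : Prop :=
  is_RInt_gen f (at_right 0) (Rbar_locally p_infty) l.

(* Coquelicot rebinds [C] to the complex numbers. *)
Definition binom (n k : nat) : R := Binomial.C n k.

(* Main.v *)
Require Import Defs.
From Stdlib Require Import Reals Factorial Lra Lia.
From Coquelicot Require Import Coquelicot.
Open Scope R_scope.

(** Rescaling [x] by [|beta|] reduces the claim to [beta = 1]. There
    [(1 - cos x) ^ p] is, up to the factor [(-1/2) ^ p], the alternating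
    binomial sum of order [2 * p] of the cosines [cos ((i - p) * x)]
    ([one_minus_cos_pow]). Such a sum kills polynomials in [i] of degree less
    than [2 * p] ([alt_sum_pow_eq_0]); hence all derivatives of order below
    [2 * p] vanish at 0 ([altcos_at_0]).

    Integrating by parts ([improper_altcos]) therefore lowers the exponent [q]
    of the denominator with no boundary terms, at the cost of the factor
    [1 / (q - 1)!], until one is left with a linear combination of
    [cos (w * x)] over [x ^ 2] ([q] even) or over [x] ([q] odd), where the
    coefficients still have sum 0. So each cosine may be corrected by the same
    function to make its own integral converge. Subtracting 1 when [q] is even
    gives integrals of [(1 - cos (w * x)) / x ^ 2], equal to [|w| * PI / 2]
    ([improper_one_minus_cos]); they reduce to the integral of
    [(sin x / x) ^ 2], which is squeezed between integrals of the Fejer kernel.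
    Subtracting [cos (p * x)] when [q] is odd gives Frullani integrals, equal
    to [ln (p / |w|)] ([improper_frullani_cos]). The stated sums over
    [k = |i - p|] result from pairing the frequencies [k] and [-k]
    ([alt_sum_even_fold]). *)

(** * Improper integrals on the positive half-line *)

(** Every limit met below is attained at speed [K * a] at 0 and [K / T] at
    infinity, so this criterion replaces filters by one explicit estimate. *)
Lemma improper_rate (f : R -> R) (l K : R) :
  (forall a T, 0 < a <= 1 -> 1 <= T ->
     exists y, is_RInt f a T y /\ Rabs (y - l) <= K * (a + / T)) ->
  is_improper_RInt_0_infty f l.
Proof.
intros H P [eps HP].
set (L := Rabs K + 1).
assert (HL : 0 < L) by (unfold L; pose proof (Rabs_pos K); lra).
assert (HKL : K <= L) by (unfold L; pose proof (Rle_abs K); lra).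
assert (He : 0 < eps / (4 * L)).
{ apply Rdiv_lt_0_compat; [apply cond_pos | lra]. }
assert (Hd : 0 < Rmin 1 (eps / (4 * L))) by (apply Rmin_glb_lt; lra).
exists (fun a => 0 < a <= 1 /\ a <= eps / (4 * L))
       (fun T => 1 <= T /\ / T <= eps / (4 * L)).
- exists (mkposreal _ Hd); intros a Ha Ha0.
  change (Rabs (a - 0) < Rmin 1 (eps / (4 * L))) in Ha.
  rewrite Rminus_0_r, Rabs_pos_eq in Ha by lra.
  pose proof (Rmin_l 1 (eps / (4 * L))).
  pose proof (Rmin_r 1 (eps / (4 * L))). lra.
- exists (Rmax 1 (/ (eps / (4 * L)))); intros T HT.
  pose proof (Rmax_l 1 (/ (eps / (4 * L)))).
  pose proof (Rmax_r 1 (/ (eps / (4 * L)))).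
  split; [lra|].
  rewrite <- (Rinv_inv (eps / (4 * L))).
  apply Rinv_le_contravar; [now apply Rinv_0_lt_compat | lra].
- intros a T [Ha Ha'] [HT HT'].
  destruct (H a T Ha HT) as [y [Hy Hb]].
  exists y; split; [exact Hy|]. apply HP.
  change (Rabs (y - l) < eps).
  assert (H0 : 0 < / T) by (apply Rinv_0_lt_compat; lra).
  assert (K * (a + / T) <= L * (a + / T)).
  { apply Rmult_le_compat_r; lra. }
  assert (L * (a + / T) <= L * (eps / (4 * L) + eps / (4 * L))).
  { apply Rmult_le_compat_l; lra. }
  replace (L * (eps / (4 * L) + eps / (4 * L))) with (eps / 2) in * by (field; lra).
  pose proof (cond_pos eps). lra.
Qed.

Lemma improper_primitive (F f : R -> R) (la lb K : R) :
  (forall x, 0 < x -> is_derive F x (f x)) ->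
  (forall x, 0 < x -> continuous f x) ->
  (forall x, 0 < x <= 1 -> Rabs (F x - la) <= K * x) ->
  (forall x, 1 <= x -> Rabs (F x - lb) <= K * / x) ->
  is_improper_RInt_0_infty f (lb - la).
Proof.
intros HD HC Ha Hb.
apply improper_rate with K; intros a T Ha1 HT.
exists (F T - F a); split.
- apply (is_RInt_derive F f); intros x; rewrite Rmin_left by lra; intros Hx.
  + apply HD; lra.
  + apply HC; lra.
- specialize (Ha a Ha1); specialize (Hb T HT).
  replace (F T - F a - (lb - la)) with ((F T - lb) + - (F a - la)) by ring.
  eapply Rle_trans; [apply Rabs_triang|]. rewrite Rabs_Ropp. lra.
Qed.

Lemma improper_eq (f : R -> R) (l l' : R) :
  l = l' -> is_improper_RInt_0_infty f l -> is_improper_RInt_0_infty f l'.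
Proof. now intros ->. Qed.

Lemma improper_ext (f g : R -> R) (l : R) :
  (forall x, 0 < x -> f x = g x) ->
  is_improper_RInt_0_infty f l -> is_improper_RInt_0_infty g l.
Proof.
intros H. apply is_RInt_gen_ext.
exists (fun a => 0 < a) (fun T => 0 < T).
- exists (mkposreal 1 Rlt_0_1); auto.
- exists 0; auto.
- simpl; intros a T Ha HT x Hx. apply H.
  pose proof (Rmin_glb_lt a T 0 Ha HT). lra.
Qed.

Lemma improper_plus (f g : R -> R) (lf lg : R) :
  is_improper_RInt_0_infty f lf -> is_improper_RInt_0_infty g lg ->
  is_improper_RInt_0_infty (fun x => f x + g x) (lf + lg).
Proof. exact (is_RInt_gen_plus f g lf lg). Qed.

Lemma improper_scal (f : R -> R) (k l : R) :
  is_improper_RInt_0_infty f l ->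
  is_improper_RInt_0_infty (fun x => k * f x) (k * l).
Proof. exact (is_RInt_gen_scal f k l). Qed.

Lemma is_RInt_cst (k a b l : R) :
  l = (b - a) * k -> is_RInt (fun _ : R => k) a b l.
Proof. intros ->. apply (is_RInt_const (V := R_NormedModule)). Qed.

Lemma improper_zero : is_improper_RInt_0_infty (fun _ => 0) 0.
Proof.
apply improper_rate with 0; intros a T Ha HT.
exists 0; split.
- apply is_RInt_cst. ring.
- rewrite Rminus_0_r, Rabs_R0. lra.
Qed.

Lemma improper_comp_scale (f : R -> R) (c l : R) :
  0 < c -> is_improper_RInt_0_infty f l ->
  is_improper_RInt_0_infty (fun x => c * f (c * x)) l.
Proof.
intros Hc Hf P HP.
destruct (Hf P HP) as [Q U [d HQ] [M HU] H].
assert (Hd : 0 < d / c) by (apply Rdiv_lt_0_compat; [apply cond_pos | lra]).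
exists (fun a => Q (c * a)) (fun T => U (c * T)).
- exists (mkposreal _ Hd); intros a Ha Ha0. apply HQ; [|nra].
  change (Rabs (a - 0) < d / c) in Ha. change (Rabs (c * a - 0) < d).
  rewrite Rminus_0_r, Rabs_pos_eq in * by nra.
  apply Rlt_div_r in Ha; lra.
- exists (M / c); intros T HT. apply HU.
  apply Rlt_div_l in HT; lra.
- intros a T Ha HT. destruct (H _ _ Ha HT) as [y [Hy Py]].
  exists y; split; [|exact Py].
  apply (is_RInt_ext (fun x => scal c (f (c * x + 0)))).
  + intros x _. now rewrite Rplus_0_r.
  + apply (is_RInt_comp_lin f c 0). simpl in Hy |- *. now rewrite !Rplus_0_r.
Qed.

(** * The integral of (sin x / x)^2, from the Fejer kernel *)

(** The kernels are cosine sums rather than quotients by [sin t]: this makes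
    them continuous at 0 and their integrals obvious. *)
Fixpoint dirichlet (n : nat) (t : R) : R :=
  match n with
  | O => 1
  | S m => dirichlet m t + 2 * cos (2 * INR (S m) * t)
  end.

Fixpoint fejer (n : nat) (t : R) : R :=
  match n with
  | O => 0
  | S m => fejer m t + dirichlet m t
  end.

Lemma dirichlet_sin (n : nat) (t : R) :
  dirichlet n t * sin t = sin ((2 * INR n + 1) * t).
Proof.
induction n as [|n IH].
- simpl. rewrite Rmult_1_l. f_equal; ring.
- change (dirichlet (S n) t) with (dirichlet n t + 2 * cos (2 * INR (S n) * t)).
  rewrite Rmult_plus_distr_r, IH, S_INR.
  replace ((2 * INR n + 1) * t) with (2 * (INR n + 1) * t - t) by ring.
  replace ((2 * (INR n + 1) + 1) * t) with (2 * (INR n + 1) * t + t) by ring.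
  rewrite sin_minus, sin_plus. ring.
Qed.

Lemma fejer_sin (n : nat) (t : R) :
  fejer n t * sin t ^ 2 = sin (INR n * t) ^ 2.
Proof.
induction n as [|n IH].
- simpl. rewrite (Rmult_0_l t), sin_0. ring.
- change (fejer (S n) t) with (fejer n t + dirichlet n t).
  rewrite Rmult_plus_distr_r, IH.
  replace (dirichlet n t * sin t ^ 2) with (dirichlet n t * sin t * sin t) by ring.
  rewrite dirichlet_sin, S_INR.
  replace ((2 * INR n + 1) * t) with (INR n * t + (INR n * t + t)) by ring.
  replace ((INR n + 1) * t) with (INR n * t + t) by ring.
  rewrite !sin_plus, cos_plus.
  pose proof (sin2_cos2 t) as E. unfold Rsqr in E.
  assert (Hc : cos t ^ 2 = 1 - sin t ^ 2) by lra.
  ring [Hc].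
Qed.

Lemma dirichlet_le (n : nat) (t : R) : dirichlet n t <= 2 * INR n + 1.
Proof.
induction n as [|n IH]; [simpl; lra|].
change (dirichlet (S n) t) with (dirichlet n t + 2 * cos (2 * INR (S n) * t)).
pose proof (COS_bound (2 * INR (S n) * t)). rewrite S_INR in *. lra.
Qed.

Lemma fejer_le (n : nat) (t : R) : fejer n t <= INR n ^ 2.
Proof.
induction n as [|n IH]; [simpl; lra|].
change (fejer (S n) t) with (fejer n t + dirichlet n t).
pose proof (dirichlet_le n t). rewrite S_INR. nra.
Qed.

Lemma continuous_dirichlet (n : nat) (t : R) : continuous (dirichlet n) t.
Proof.
induction n as [|n IH]; [apply continuous_const|].
apply (continuous_plus (dirichlet n)); [exact IH|].
apply (ex_derive_continuous (fun t => 2 * cos (2 * INR (S n) * t))).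
auto_derive; auto.
Qed.

Lemma continuous_fejer (n : nat) (t : R) : continuous (fejer n) t.
Proof.
induction n as [|n IH]; [apply continuous_const|].
apply (continuous_plus (fejer n)); [exact IH | apply continuous_dirichlet].
Qed.

Lemma RInt_dirichlet (n : nat) : is_RInt (dirichlet n) 0 (PI / 2) (PI / 2).
Proof.
induction n as [|n IH].
- apply is_RInt_cst. ring.
- replace (PI / 2) with (plus (PI / 2) 0) at 2 by apply Rplus_0_r.
  apply (is_RInt_plus (dirichlet n)); [exact IH|].
  set (k := INR (S n)).
  assert (Hk : 0 < k) by (apply lt_0_INR; lia).
  replace 0 with (minus (sin (2 * k * (PI / 2)) / k) (sin (2 * k * 0) / k)) at 2.
  + apply (is_RInt_derive (fun t => sin (2 * k * t) / k)).
    * intros x _. auto_derive; [auto|]. field; lra.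
    * intros x _. apply (ex_derive_continuous (fun t => 2 * cos (2 * k * t))).
      auto_derive; auto.
  + replace (2 * k * (PI / 2)) with (k * PI) by field.
    rewrite Rmult_0_r, sin_0, (sin_eq_0_1 (k * PI)).
    * unfold minus, plus, opp; simpl. field; lra.
    * exists (Z.of_nat (S n)). unfold k. now rewrite INR_IZR_INZ.
Qed.

Lemma RInt_fejer (n : nat) : is_RInt (fejer n) 0 (PI / 2) (INR n * (PI / 2)).
Proof.
induction n as [|n IH].
- apply is_RInt_cst. simpl; ring.
- rewrite S_INR, Rmult_plus_distr_r, Rmult_1_l.
  apply (is_RInt_plus (fejer n)); [exact IH | apply RInt_dirichlet].
Qed.

(** [sin t - t * cos t] vanishes at 0 and has derivative [t * sin t]. This is
    the inequality [t <= tan t] without its pole at [PI / 2]. *)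
Lemma mul_cos_le_sin (t : R) : 0 <= t <= PI -> t * cos t <= sin t.
Proof.
intros Ht.
destruct (MVT_gen (fun t => sin t - t * cos t) 0 t (fun t => t * sin t))
  as [c [Hc E]].
- intros x _. auto_derive; [auto|]. ring.
- intros x _. apply continuity_pt_filterlim.
  apply (ex_derive_continuous (fun t => sin t - t * cos t)). auto_derive; auto.
- rewrite Rmin_left, Rmax_right in Hc by lra.
  rewrite sin_0 in E.
  pose proof (sin_ge_0 c ltac:(lra) ltac:(lra)).
  assert (0 <= c * sin c * (t - 0)) by (apply Rmult_le_pos; [apply Rmult_le_pos|]; lra).
  lra.
Qed.

Definition sinc2 (x : R) : R := sin x ^ 2 / x ^ 2.

Lemma sinc2_ge_0 (x : R) : 0 < x -> 0 <= sinc2 x.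
Proof.
intros Hx. apply Rdiv_le_0_compat; [apply pow2_ge_0 | now apply pow_lt].
Qed.

Lemma ex_RInt_sinc2 (a b : R) : 0 < a -> 0 < b -> ex_RInt sinc2 a b.
Proof.
intros Ha Hb.
apply (ex_RInt_continuous (V := R_CompleteNormedModule)); intros x Hx.
assert (0 < x) by (pose proof (Rmin_glb_lt a b 0 Ha Hb); lra).
apply (ex_derive_continuous (fun x => sin x ^ 2 / x ^ 2)).
auto_derive. apply Rgt_not_eq; nra.
Qed.

(** From [sin t <= t <= tan t] follows
    [1 / sin t ^ 2 - 1 <= 1 / t ^ 2 <= 1 / sin t ^ 2]; multiply by
    [sin (n * t) ^ 2], which is at most 1 and equals [fejer n t * sin t ^ 2]. *)
Lemma fejer_bounds (n : nat) (t : R) : 0 < t <= PI / 2 ->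
  fejer n t - 1 <= sin (INR n * t) ^ 2 / t ^ 2 <= fejer n t.
Proof.
intros Ht. pose proof PI_RGT_0.
assert (Hs : 0 < sin t) by (apply sin_gt_0; lra).
assert (Hlt : sin t < t) by (apply sin_lt_x; lra).
assert (Hc : 0 <= cos t) by (apply cos_ge_0; lra).
assert (Htc := mul_cos_le_sin t ltac:(lra)).
assert (Hf := fejer_sin n t).
assert (Hu : sin (INR n * t) ^ 2 <= 1).
{ pose proof (SIN_bound (INR n * t)). nra. }
set (u := sin (INR n * t) ^ 2) in *.
assert (Hu0 : 0 <= u) by apply pow2_ge_0.
assert (Hs2 : 0 < sin t ^ 2) by (now apply pow_lt).
assert (Hf0 : 0 <= fejer n t) by nra.
assert (Ht2 : 0 < t ^ 2) by (apply pow_lt; lra).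
pose proof (sin2_cos2 t) as E; unfold Rsqr in E.
assert (Htc2 : t ^ 2 * (1 - sin t ^ 2) <= sin t ^ 2).
{ replace (1 - sin t ^ 2) with (cos t ^ 2) by (simpl; lra).
  rewrite <- Rpow_mult_distr. apply pow_incr. split; [|lra].
  apply Rmult_le_pos; lra. }
assert (Hs2' : sin t ^ 2 <= t ^ 2) by (apply pow_incr; lra).
split.
- apply Rle_div_r; [exact Ht2|].
  assert (fejer n t * (t ^ 2 * (1 - sin t ^ 2)) <= fejer n t * sin t ^ 2)
    by now apply Rmult_le_compat_l.
  nra.
- apply Rle_div_l; [exact Ht2|].
  rewrite <- Hf. now apply Rmult_le_compat_l.
Qed.

(** The substitution [x = n * t] turns the integral into [1 / n] times that of
    [sin (n * t) ^ 2 / t ^ 2] up to [PI / 2], which [fejer_bounds] compares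
    with the Fejer kernel, of integral [n * PI / 2]. The piece of the kernel
    below [a / n], at most [n ^ 2 * (a / n)], accounts for the term [a], and
    the 1 lost in [fejer_bounds] for the term [PI / (2 * n)]. *)
Lemma RInt_sinc2_bounds (n : nat) (a : R) : (1 <= n)%nat -> 0 < a <= 1 ->
  PI / 2 - a - PI / (2 * INR n) <= RInt sinc2 a (INR n * (PI / 2)) <= PI / 2.
Proof.
intros Hn Ha.
assert (Hn1 : 1 <= INR n) by (apply (le_INR 1); exact Hn).
pose proof PI2_1 as HPI.
assert (Han : 0 < a / INR n) by (apply Rdiv_lt_0_compat; lra).
assert (Han1 : a / INR n <= 1) by (apply Rle_div_l; lra).
assert (HI : is_RInt (fun t => sin (INR n * t) ^ 2 / t ^ 2) (a / INR n) (PI / 2)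
          (INR n * RInt sinc2 a (INR n * (PI / 2)))).
{ apply (is_RInt_ext (fun t => scal (INR n) (scal (INR n) (sinc2 (INR n * t + 0))))).
  - intros t Ht. rewrite Rmin_left in Ht by lra.
    unfold sinc2, scal; simpl; unfold mult; simpl. rewrite Rplus_0_r. field. lra.
  - apply (is_RInt_scal (fun t => scal (INR n) (sinc2 (INR n * t + 0)))).
    apply (is_RInt_comp_lin sinc2).
    replace (INR n * (a / INR n) + 0) with a by (field; lra).
    rewrite Rplus_0_r. apply (RInt_correct (V := R_CompleteNormedModule)).
    apply ex_RInt_sinc2; nra. }
set (J := RInt sinc2 a (INR n * (PI / 2))) in *.
assert (H0 : exists e : R, is_RInt (fejer n) 0 (a / INR n) e).
{ apply (ex_RInt_continuous (V := R_CompleteNormedModule)).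
  intros; apply continuous_fejer. }
destruct H0 as [e H0].
assert (HF : is_RInt (fejer n) (a / INR n) (PI / 2) (INR n * (PI / 2) - e)).
{ replace (INR n * (PI / 2) - e) with (plus (opp e) (INR n * (PI / 2)))
    by (unfold plus, opp; simpl; ring).
  apply (is_RInt_Chasles (V := R_NormedModule)) with 0.
  - now apply (is_RInt_swap (V := R_NormedModule)).
  - apply RInt_fejer. }
assert (HC : forall k a b, is_RInt (fun _ => k) a b ((b - a) * k)).
{ intros k u v. now apply is_RInt_cst. }
assert (He0 : 0 <= e).
{ rewrite <- (Rmult_0_r (a / INR n - 0)).
  apply (is_RInt_le (fun _ => 0) (fejer n) 0 (a / INR n)); auto; [lra|].
  intros t Ht. eapply Rle_trans; [|apply (fejer_bounds n t); lra].
  apply Rdiv_le_0_compat; [apply pow2_ge_0 | apply pow_lt; lra]. }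
assert (He1 : e <= INR n * a).
{ replace (INR n * a) with ((a / INR n - 0) * INR n ^ 2) by (field; lra).
  apply (is_RInt_le (fejer n) (fun _ => INR n ^ 2) 0 (a / INR n)); auto; [lra|].
  intros t Ht. apply fejer_le. }
assert (Hup : INR n * J <= INR n * (PI / 2) - e).
{ apply (is_RInt_le _ _ (a / INR n) (PI / 2) _ _ ltac:(lra) HI HF).
  intros t Ht. apply fejer_bounds; lra. }
assert (Hlo : INR n * (PI / 2) - e - (PI / 2 - a / INR n) * 1 <= INR n * J).
{ refine (is_RInt_le _ _ (a / INR n) (PI / 2) _ _ ltac:(lra)
    (is_RInt_minus _ _ _ _ _ _ HF (HC 1 _ _)) HI _).
  intros t Ht. apply fejer_bounds; lra. }
split.
- apply (Rmult_le_reg_l (INR n)); [lra|].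
  replace (INR n * (PI / 2 - a - PI / (2 * INR n)))
    with (INR n * (PI / 2) - INR n * a - PI / 2) by (field; lra).
  lra.
- apply (Rmult_le_reg_l (INR n)); lra.
Qed.

(** The integrand is nonnegative, so the integral up to [T] lies between those
    up to the multiples of [PI / 2] on either side of [T]. *)
Lemma improper_sinc2 : is_improper_RInt_0_infty sinc2 (PI / 2).
Proof.
(* 8 covers PI^2 / 2, the loss when T is cut down to a multiple of PI / 2, as
   PI <= 4. *)
apply improper_rate with 8; intros a T Ha HT.
pose proof PI2_1 as HPI. pose proof PI_4 as HPI4.
exists (RInt sinc2 a T); split.
{ apply (RInt_correct (V := R_CompleteNormedModule)). apply ex_RInt_sinc2; lra. }
assert (Hmono : forall u v, 0 < u <= v -> 0 <= RInt sinc2 u v).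
{ intros u v Huv. apply RInt_ge_0; [lra | apply ex_RInt_sinc2; lra |].
  intros x Hx. apply sinc2_ge_0; lra. }
assert (Hcut : forall u v, a <= u <= v -> RInt sinc2 a u <= RInt sinc2 a v).
{ intros u v Huv.
  rewrite <- (RInt_Chasles sinc2 a u v) by (apply ex_RInt_sinc2; lra).
  specialize (Hmono u v ltac:(lra)). unfold plus; simpl. lra. }
assert (Hx : 0 <= 2 * T / PI) by (apply Rdiv_le_0_compat; lra).
destruct (nfloor_ex _ Hx) as [n [Hn1 Hn2]].
apply Rle_div_r in Hn1; [|lra]. apply Rlt_div_l in Hn2; [|lra].
assert (HT0 : 0 < / T) by (apply Rinv_0_lt_compat; lra).
assert (HTi : T * / T = 1) by (apply Rinv_r; lra).
assert (Hup : RInt sinc2 a T <= PI / 2).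
{ eapply Rle_trans; [apply (Hcut T (INR (S n) * (PI / 2)))|].
  - rewrite S_INR. split; lra.
  - apply RInt_sinc2_bounds; [lia | lra]. }
assert (Hlo : PI / 2 - 8 * (a + / T) <= RInt sinc2 a T).
{ destruct n as [|n].
  - (* Here T < PI / 2 <= 2, so 8 / T exceeds PI / 2 and the bound is void. *)
    specialize (Hmono a T ltac:(lra)). simpl in Hn2. nra.
  - assert (HN : 1 <= INR (S n)) by (apply (le_INR 1); lia).
    eapply Rle_trans; [|apply (Hcut (INR (S n) * (PI / 2)) T); nra].
    eapply Rle_trans; [|apply RInt_sinc2_bounds; [lia | lra]].
    assert (PI / (2 * INR (S n)) <= 8 * / T); [|lra].
    apply Rle_div_l; [lra|].
    apply (Rmult_le_reg_l T); [lra|].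
    replace (T * (8 * / T * (2 * INR (S n)))) with (16 * INR (S n) * (T * / T)) by ring.
    rewrite HTi. nra. }
apply Rabs_le. lra.
Qed.

Lemma cos_Rabs_mul (w x : R) : cos (Rabs w * x) = cos (w * x).
Proof.
unfold Rabs; destruct (Rcase_abs w); [|reflexivity].
rewrite <- cos_neg. f_equal; ring.
Qed.

(** [1 - cos (w * x) = 2 * sin (w * x / 2) ^ 2], a rescaled [sinc2]. *)
Lemma improper_one_minus_cos (w : R) :
  is_improper_RInt_0_infty (fun x => (1 - cos (w * x)) / x ^ 2) (Rabs w * (PI / 2)).
Proof.
destruct (Req_dec w 0) as [->|Hw].
- rewrite Rabs_R0, Rmult_0_l. apply (improper_ext (fun _ => 0)).
  + intros x Hx. rewrite Rmult_0_l, cos_0. unfold Rdiv; ring.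
  + exact improper_zero.
- pose proof (Rabs_pos_lt w Hw) as Hw0.
  apply (improper_ext (fun x => Rabs w * (Rabs w / 2 * sinc2 (Rabs w / 2 * x)))).
  + intros x Hx.
    replace (cos (w * x)) with (1 - 2 * sin (Rabs w / 2 * x) ^ 2).
    * unfold sinc2. field. lra.
    * transitivity (cos (2 * (Rabs w / 2 * x))).
      -- rewrite cos_2a_sin. ring.
      -- replace (2 * (Rabs w / 2 * x)) with (Rabs w * x) by field.
         apply cos_Rabs_mul.
  + apply improper_scal, (improper_comp_scale sinc2); [lra | exact improper_sinc2].
Qed.

(** * Frullani's integral for the cosine *)

Lemma Rabs_increment_le (g dg : R -> R) (u v M : R) :
  (forall x, Rmin u v <= x <= Rmax u v -> is_derive g x (dg x) /\ Rabs (dg x) <= M) ->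
  Rabs (g v - g u) <= M * Rabs (v - u).
Proof.
intros H.
destruct (MVT_gen g u v dg) as [c [Hc E]].
- intros x Hx. apply H; lra.
- intros x Hx. apply continuity_pt_filterlim.
  apply (ex_derive_continuous g). exists (dg x). now apply H.
- rewrite E, Rabs_mult. apply Rmult_le_compat_r; [apply Rabs_pos | now apply H].
Qed.

Lemma ex_primitive_cos_div :
  exists F : R -> R, forall x, 0 < x -> is_derive F x (cos x / x).
Proof.
assert (HC : forall x, 0 < x -> continuous (fun t => cos t / t) x).
{ intros x Hx. apply (ex_derive_continuous (fun t => cos t / t)).
  auto_derive. lra. }
exists (RInt (fun t => cos t / t) 1); intros x Hx.
apply (is_derive_RInt (fun t => cos t / t) _ 1); [|now apply HC].
exists (mkposreal x Hx); intros y Hy.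
change (Rabs (y - x) < x) in Hy. apply Rabs_lt_between in Hy.
apply (RInt_correct (V := R_CompleteNormedModule)).
apply (ex_RInt_continuous (V := R_CompleteNormedModule)); intros z Hz.
apply HC. pose proof (Rmin_glb_lt 1 y 0 Rlt_0_1 ltac:(lra)). lra.
Qed.

Lemma Rabs_cos_sub_1 (x : R) : 0 < x -> Rabs (cos x - 1) <= x.
Proof.
intros Hx.
rewrite <- cos_0. rewrite <- (Rmult_1_l x) at 2.
rewrite <- (Rabs_pos_eq x) at 2 by lra. rewrite <- (Rminus_0_r x) at 2.
apply (Rabs_increment_le cos (fun t => - sin t)).
intros y _. split.
- auto_derive; [auto|]. ring.
- rewrite Rabs_Ropp. apply Rabs_le. apply SIN_bound.
Qed.

(** With [F] a primitive of [cos x / x], the integrand has primitive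
    [F (a * x) - F (c * x)]. Near 0 the function [F] differs from [ln] by a
    Lipschitz function, so this tends to [ln (a / c)]; near infinity it
    differs from [sin x / x] by a function of derivative [sin x / x ^ 2], so
    it tends to 0. *)
Lemma improper_frullani_cos (a c : R) : 0 < a -> 0 < c ->
  is_improper_RInt_0_infty (fun x => (cos (a * x) - cos (c * x)) / x) (ln (c / a)).
Proof.
intros Ha Hc.
destruct ex_primitive_cos_div as [F HF].
set (m := Rmin a c).
assert (Hm : 0 < m) by now apply Rmin_glb_lt.
assert (Hln : ln (c / a) = 0 - (ln a - ln c)).
{ unfold Rdiv. rewrite ln_mult, ln_Rinv; auto using Rinv_0_lt_compat. ring. }
rewrite Hln.
set (d := Rabs (a - c)).
assert (Hd : 0 <= d) by apply Rabs_pos.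
assert (Hscale : forall x, 0 < x -> Rabs (a * x - c * x) = d * x).
{ intros x Hx. rewrite <- Rmult_minus_distr_r, Rabs_mult, (Rabs_pos_eq x); [reflexivity|lra]. }
assert (Hmin : forall x y, 0 < x -> Rmin (c * x) (a * x) <= y -> m * x <= y).
{ intros x y Hx Hy. eapply Rle_trans; [|exact Hy].
  apply Rmin_glb; apply Rmult_le_compat_r; try lra; [apply Rmin_r | apply Rmin_l]. }
assert (Hinv : forall y, 0 < y -> 0 < / y) by (intros; now apply Rinv_0_lt_compat).
assert (Hm2 : 0 <= d / m ^ 2) by (apply Rdiv_le_0_compat; [lra | now apply pow_lt]).
pose proof (Hinv a Ha) as Ha'. pose proof (Hinv c Hc) as Hc'.
apply (improper_primitive (fun x => F (a * x) - F (c * x))) with (d + d / m ^ 2 + / a + / c).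
- intros x Hx.
  assert (Hs : forall k, 0 < k -> is_derive (fun x => F (k * x)) x (cos (k * x) / x)).
  { intros k Hk.
    replace (cos (k * x) / x) with (scal k (cos (k * x) / (k * x)))
      by (unfold scal; simpl; unfold mult; simpl; field; lra).
    apply (is_derive_comp F (fun x => k * x)).
    - apply HF. now apply Rmult_lt_0_compat.
    - auto_derive; [auto|]. ring. }
  replace ((cos (a * x) - cos (c * x)) / x)
    with (minus (cos (a * x) / x) (cos (c * x) / x))
    by (unfold minus, plus, opp; simpl; field; lra).
  apply (is_derive_minus (fun x => F (a * x)) (fun x => F (c * x))); auto.
- intros x Hx. apply (ex_derive_continuous (fun x => (cos (a * x) - cos (c * x)) / x)).
  auto_derive. lra.
- intros x Hx.
  apply Rle_trans with (d * x).
  2:{ apply Rmult_le_compat_r; lra. }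
  replace (F (a * x) - F (c * x) - (ln a - ln c))
    with ((F (a * x) - ln (a * x)) - (F (c * x) - ln (c * x)))
    by (rewrite !ln_mult by lra; ring).
  rewrite <- Hscale, <- (Rmult_1_l (Rabs (a * x - c * x))) by lra.
  apply (Rabs_increment_le (fun y => F y - ln y) (fun y => (cos y - 1) / y)).
  intros y [Hy _]. apply Hmin in Hy; [|lra].
  assert (Hy0 : 0 < y) by nra. split.
  + replace ((cos y - 1) / y) with (minus (cos y / y) (/ y))
      by (unfold minus, plus, opp; simpl; field; lra).
    apply (is_derive_minus F ln); [now apply HF | now apply is_derive_ln].
  + unfold Rdiv. rewrite Rabs_mult, (Rabs_pos_eq (/ y)) by (left; auto).
    apply Rle_div_l; [lra|]. rewrite Rmult_1_l. now apply Rabs_cos_sub_1.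
- intros x Hx. rewrite Rminus_0_r.
  assert (Hinc : Rabs ((F (a * x) - sin (a * x) / (a * x))
                     - (F (c * x) - sin (c * x) / (c * x)))
                 <= d / m ^ 2 * / x).
  { replace (d / m ^ 2 * / x) with (/ (m * x) ^ 2 * (d * x)) by (field; lra).
    rewrite <- Hscale by lra.
    apply (Rabs_increment_le (fun y => F y - sin y / y) (fun y => sin y / y ^ 2)).
    intros y [Hy _]. apply Hmin in Hy; [|lra].
    assert (Hmx : 0 < m * x) by nra.
    assert (Hy0 : 0 < y) by lra. split.
    - replace (sin y / y ^ 2) with (minus (cos y / y) (cos y / y - sin y / y ^ 2))
        by (unfold minus, plus, opp; simpl; field; lra).
      apply (is_derive_minus F (fun y => sin y / y)); [now apply HF|].
      auto_derive; [lra|]. field. lra.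
    - assert (0 < y ^ 2) by now apply pow_lt.
      unfold Rdiv. rewrite Rabs_mult, (Rabs_pos_eq (/ y ^ 2)) by (left; auto).
      rewrite <- (Rmult_1_l (/ (m * x) ^ 2)).
      apply Rmult_le_compat; [apply Rabs_pos | left; auto | apply Rabs_le, SIN_bound |].
      apply Rinv_le_contravar; [now apply pow_lt | apply pow_incr; lra]. }
  assert (Hb : forall k, 0 < k -> Rabs (sin (k * x) / (k * x)) <= / k * / x).
  { intros k Hk. assert (0 < k * x) by nra.
    unfold Rdiv. rewrite Rabs_mult, (Rabs_pos_eq (/ (k * x))) by (left; auto).
    rewrite <- Rinv_mult. rewrite <- (Rmult_1_l (/ (k * x))) at 2.
    apply Rmult_le_compat_r; [left; auto | apply Rabs_le, SIN_bound]. }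
  replace (F (a * x) - F (c * x))
    with (((F (a * x) - sin (a * x) / (a * x)) - (F (c * x) - sin (c * x) / (c * x)))
          + (sin (a * x) / (a * x) - sin (c * x) / (c * x))) by ring.
  eapply Rle_trans; [apply Rabs_triang|].
  assert (Rabs (sin (a * x) / (a * x) - sin (c * x) / (c * x)) <= / a * / x + / c * / x).
  { unfold Rminus. eapply Rle_trans; [apply Rabs_triang|]. rewrite Rabs_Ropp.
    apply Rplus_le_compat; auto. }
  assert (0 <= d * / x) by (apply Rmult_le_pos; [lra | left; apply Hinv; lra]).
  lra.
Qed.

(** * Alternating binomial sums *)

(** The [n]-th finite difference at 0, up to the sign [(-1) ^ n], that is, the
    sum of [(-1) ^ i * binom n i * g i] (see [alt_sum_eq_sum]). In the recursive
    form every linear property is an immediate induction. *)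
Fixpoint alt_sum (n : nat) (g : nat -> R) : R :=
  match n with
  | O => g O
  | S m => alt_sum m (fun i => g i - g (S i))
  end.

Lemma alt_sum_ext (n : nat) (g h : nat -> R) :
  (forall i, g i = h i) -> alt_sum n g = alt_sum n h.
Proof.
revert g h; induction n as [|n IH]; intros g h H; [exact (H O)|].
apply IH; intros i. now rewrite !H.
Qed.

Lemma alt_sum_minus (n : nat) (g h : nat -> R) :
  alt_sum n (fun i => g i - h i) = alt_sum n g - alt_sum n h.
Proof.
revert g h; induction n as [|n IH]; intros g h; [reflexivity|].
simpl. rewrite <- IH. apply alt_sum_ext; intros i. ring.
Qed.

Lemma alt_sum_scal (n : nat) (k : R) (g : nat -> R) :
  alt_sum n (fun i => k * g i) = k * alt_sum n g.
Proof.
revert g; induction n as [|n IH]; intros g; [reflexivity|].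
simpl. rewrite <- IH. apply alt_sum_ext; intros i. ring.
Qed.

Lemma alt_sum_is_derive (n : nat) (g dg : nat -> R -> R) (x : R) :
  (forall i, is_derive (g i) x (dg i x)) ->
  is_derive (fun x => alt_sum n (fun i => g i x)) x (alt_sum n (fun i => dg i x)).
Proof.
revert g dg; induction n as [|n IH]; intros g dg H; [exact (H O)|].
apply (IH (fun i x => g i x - g (S i) x) (fun i x => dg i x - dg (S i) x)).
intros i. apply (is_derive_minus (g i) (g (S i))); apply H.
Qed.

Lemma alt_sum_improper (n : nat) (g : nat -> R -> R) (l : nat -> R) :
  (forall i, is_improper_RInt_0_infty (g i) (l i)) ->
  is_improper_RInt_0_infty (fun x => alt_sum n (fun i => g i x)) (alt_sum n l).
Proof.
revert g l; induction n as [|n IH]; intros g l H; [exact (H O)|].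
apply (IH (fun i x => g i x - g (S i) x)).
intros i. exact (is_RInt_gen_minus _ _ _ _ (H i) (H (S i))).
Qed.

Lemma alt_sum_bounded (n : nat) (g : nat -> R -> R) :
  (forall i, exists M, forall x, Rabs (g i x) <= M) ->
  exists M, forall x, Rabs (alt_sum n (fun i => g i x)) <= M.
Proof.
revert g; induction n as [|n IH]; intros g H; [exact (H O)|].
apply (IH (fun i x => g i x - g (S i) x)). intros i.
destruct (H i) as [M1 H1]. destruct (H (S i)) as [M2 H2].
exists (M1 + M2); intros x. unfold Rminus.
eapply Rle_trans; [apply Rabs_triang|]. rewrite Rabs_Ropp.
now apply Rplus_le_compat.
Qed.

(** Multiplying by a linear factor raises by at most one the order of the
    difference that kills a sequence, because
    [(x_i) g_i - (x_i + 1) g_(i+1) = x_i (g_i - g_(i+1)) - g_(i+1)]. All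
    shifts [s] are needed since the last term is shifted. *)
Lemma alt_sum_mul_linear (n : nat) (a : R) (g : nat -> R) :
  (forall s, alt_sum n (fun i => g (s + i)%nat) = 0) ->
  forall s, alt_sum (S n) (fun i => (INR (s + i) - a) * g (s + i)%nat) = 0.
Proof.
revert g; induction n as [|n IH]; intros g H s.
- simpl. pose proof (H s) as H1. pose proof (H (s + 1)%nat) as H2.
  simpl in H1, H2. rewrite !Nat.add_0_r in *. rewrite H1, H2. ring.
- change (alt_sum (S n) (fun i => (INR (s + i) - a) * g (s + i)%nat
                      - (INR (s + S i) - a) * g (s + S i)%nat) = 0).
  rewrite (alt_sum_ext _ _ (fun i => (INR (s + i) - a) * (g (s + i)%nat - g (S (s + i)))
                      - g (S s + i)%nat)).
  + rewrite alt_sum_minus, H.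
    rewrite (IH (fun i => g i - g (S i))); [ring|].
    intros r. specialize (H r). simpl in H. rewrite <- H.
    apply alt_sum_ext; intros i. now rewrite Nat.add_succ_r.
  + intros i. rewrite Nat.add_succ_r, S_INR. simpl. ring.
Qed.

Lemma alt_sum_pow_eq_0 (n j : nat) (a : R) :
  (j < n)%nat -> alt_sum n (fun i => (INR i - a) ^ j) = 0.
Proof.
intros Hj.
enough (H : forall s, alt_sum n (fun i => (INR (s + i) - a) ^ j) = 0) by apply (H O).
revert j Hj; induction n as [|n IH]; intros j Hj s; [lia|].
destruct j as [|j].
- clear. simpl. rewrite (alt_sum_ext _ _ (fun i => 0 * 0)); [|intros; ring].
  rewrite (alt_sum_scal n 0 (fun _ => 0)). ring.
- apply (alt_sum_mul_linear n a (fun i => (INR i - a) ^ j)).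
  apply IH; lia.
Qed.

(** Pascal's rule, by summation by parts. *)
Lemma alt_sum_eq_sum (n : nat) (g : nat -> R) :
  alt_sum n g = sum_n_m (fun i => (-1) ^ i * binom n i * g i) 0 n.
Proof.
unfold binom.
revert g; induction n as [|n IH]; intros g.
- rewrite sum_n_n. simpl. unfold Binomial.C; simpl. field.
- simpl alt_sum. rewrite IH.
  (* The partial sums differ by one boundary term. *)
  assert (H : forall m, (m <= n)%nat ->
    sum_n_m (fun i => (-1) ^ i * Binomial.C n i * (g i - g (S i))) 0 m =
    sum_n_m (fun i => (-1) ^ i * Binomial.C (S n) i * g i) 0 m
      + (-1) ^ S m * Binomial.C n m * g (S m)).
  { assert (H0 : forall k, Binomial.C k 0 = 1).
    { intros k. unfold Binomial.C. rewrite Nat.sub_0_r. simpl. field.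
      apply INR_fact_neq_0. }
    induction m as [|m IHm]; intros Hm.
    - rewrite !sum_n_n, !H0. simpl; ring.
    - rewrite !sum_n_Sm, IHm by lia. unfold plus; simpl.
      rewrite <- (pascal n m) by lia. ring. }
  rewrite H by lia. rewrite (sum_n_Sm _ 0 n) by lia.
  assert (H1 : forall k, Binomial.C k k = 1).
  { intros k. unfold Binomial.C. rewrite Nat.sub_diag. simpl. field.
    apply INR_fact_neq_0. }
  rewrite !H1. reflexivity.
Qed.

Lemma sum_fold (p : nat) (u : nat -> R) :
  sum_n_m u 0 (2 * p) =
  u p + sum_n_m (fun k => u (p - k)%nat + u (p + k)%nat) 1 p.
Proof.
revert u; induction p as [|p IH]; intros u.
- rewrite (sum_n_m_zero _ 1 0) by lia. simpl. rewrite sum_n_n.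
  unfold zero; simpl; ring.
- replace (2 * S p)%nat with (S (S (2 * p))) by lia.
  rewrite sum_n_Sm, sum_Sn_m, <- (sum_n_m_S u), IH, (sum_n_Sm _ 1 p) by lia.
  rewrite (sum_n_m_ext_loc (fun k => u (S p - k)%nat + u (S p + k)%nat)
             (fun k => u (S (p - k)) + u (S (p + k)))).
  + rewrite Nat.sub_diag. replace (S p + S p)%nat with (S (S (2 * p))) by lia.
    unfold plus; simpl. ring.
  + intros k Hk. now replace (S p - k)%nat with (S (p - k)) by lia.
Qed.

(** The terms [p - k] and [p + k] coincide: [phi] is even, the binomial
    coefficient symmetric, and [p - k], [p + k] have the same parity. *)
Lemma alt_sum_even_fold (p : nat) (phi : R -> R) :
  phi 0 = 0 -> (forall x, phi (- x) = phi x) ->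
  alt_sum (2 * p) (fun i => phi (INR i - INR p)) =
  2 * (-1) ^ p *
    sum_n_m (fun k => (-1) ^ k * binom (2 * p) (p - k) * phi (INR k)) 1 p.
Proof.
intros H0 He. rewrite alt_sum_eq_sum, sum_fold.
rewrite Rminus_diag_eq, H0, Rmult_0_r, Rplus_0_l by reflexivity.
rewrite <- (sum_n_m_mult_l (K := R_Ring)).
apply sum_n_m_ext_loc; intros k Hk.
unfold mult; simpl mult. unfold binom.
rewrite (pascal_step1 (2 * p) (p + k)) by lia.
replace (2 * p - (p + k))%nat with (p - k)%nat by lia.
rewrite minus_INR, plus_INR by lia.
replace (INR p - INR k - INR p) with (- INR k) by ring.
replace (INR p + INR k - INR p) with (INR k) by ring.
rewrite He, pow_add.
assert (E : (-1) ^ p = (-1) ^ (p - k) * (-1) ^ k).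
{ rewrite <- pow_add. f_equal; lia. }
assert (E1 : (-1) ^ k * (-1) ^ k = 1).
{ rewrite <- Rpow_mult_distr. replace (-1 * -1) with 1 by ring. apply pow1. }
rewrite E. set (B := Binomial.C (2 * p) (p - k)). simpl.
transitivity ((-1) ^ (p - k) * (1 + (-1) ^ k * (-1) ^ k) * B * phi (INR k)); [ring|].
transitivity (2 * (-1) ^ (p - k) * ((-1) ^ k * (-1) ^ k) * B * phi (INR k)); [|ring].
rewrite E1. ring.
Qed.

(** Two difference steps on a cosine of step [t] multiply it by
    [-2 * (1 - cos t)], as
    [cos (f - t) - 2 * cos f + cos (f + t) = -2 * (1 - cos t) * cos f]. *)
Lemma one_minus_cos_pow (p : nat) (t : R) :
  (1 - cos t) ^ p = (- / 2) ^ p * alt_sum (2 * p) (fun i => cos ((INR i - INR p) * t)).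
Proof.
induction p as [|p IH].
- simpl. rewrite Rminus_diag_eq, Rmult_0_l, cos_0 by reflexivity. ring.
- replace (2 * S p)%nat with (S (S (2 * p))) by lia.
  change (alt_sum (S (S (2 * p))) ?g)
    with (alt_sum (2 * p) (fun i => (g i - g (S i)) - (g (S i) - g (S (S i))))).
  cbv beta.
  rewrite (alt_sum_ext _ _ (fun i => (- 2 * (1 - cos t)) * cos ((INR i - INR p) * t))).
  + rewrite alt_sum_scal. simpl pow. rewrite IH. simpl. field.
  + intros i. rewrite !S_INR. set (f := (INR i - INR p) * t).
    replace ((INR i - (INR p + 1)) * t) with (f - t) by (unfold f; ring).
    replace ((INR i + 1 - (INR p + 1)) * t) with f by (unfold f; ring).
    replace ((INR i + 1 + 1 - (INR p + 1)) * t) with (f + t) by (unfold f; ring).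
    rewrite cos_minus, cos_plus. ring.
Qed.

(** * The derivatives of (1 - cos x)^p *)

(** The [j]-th derivative of the alternating sum of [cos ((i - a) * x)]; the
    phase [j * PI / 2] treats sines and cosines alike. For [N = 2 * p] and
    [a = p] these are the derivatives of [(1 - cos x) ^ p], up to a factor. *)
Definition altcos (N : nat) (a : R) (j : nat) (x : R) : R :=
  alt_sum N (fun i => (INR i - a) ^ j * cos ((INR i - a) * x + INR j * (PI / 2))).

Lemma is_derive_altcos (N : nat) (a : R) (j : nat) (x : R) :
  is_derive (altcos N a j) x (altcos N a (S j) x).
Proof.
apply (alt_sum_is_derive N
  (fun i x => (INR i - a) ^ j * cos ((INR i - a) * x + INR j * (PI / 2)))
  (fun i x => (INR i - a) ^ S j * cos ((INR i - a) * x + INR (S j) * (PI / 2)))).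
intros i. rewrite S_INR.
replace ((INR i - a) * x + (INR j + 1) * (PI / 2))
  with (PI / 2 + ((INR i - a) * x + INR j * (PI / 2))) by ring.
rewrite <- (Ropp_involutive (cos (PI / 2 + _))), <- sin_cos.
auto_derive; [auto|]. simpl; ring.
Qed.

Lemma continuous_altcos (N : nat) (a : R) (j : nat) (x : R) :
  continuous (altcos N a j) x.
Proof.
apply (ex_derive_continuous (altcos N a j)).
exists (altcos N a (S j) x). apply is_derive_altcos.
Qed.

Lemma altcos_bounded (N : nat) (a : R) (j : nat) :
  exists M, forall x, Rabs (altcos N a j x) <= M.
Proof.
apply (alt_sum_bounded N
  (fun i x => (INR i - a) ^ j * cos ((INR i - a) * x + INR j * (PI / 2)))).
intros i. exists (Rabs ((INR i - a) ^ j) * 1); intros x.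
rewrite Rabs_mult. apply Rmult_le_compat_l; [apply Rabs_pos|].
apply Rabs_le, COS_bound.
Qed.

(** At 0 what remains is the alternating sum of the [j]-th powers. *)
Lemma altcos_at_0 (N : nat) (a : R) (j : nat) : (j < N)%nat -> altcos N a j 0 = 0.
Proof.
intros Hj. unfold altcos.
rewrite (alt_sum_ext _ _ (fun i => cos (INR j * (PI / 2)) * (INR i - a) ^ j)).
- rewrite alt_sum_scal, alt_sum_pow_eq_0 by exact Hj. ring.
- intros i. rewrite Rmult_0_r, Rplus_0_l. ring.
Qed.

(** All derivatives of order [j < N] vanish at 0 and that of order [N] is
    bounded; integrate down from it. *)
Lemma altcos_small (N : nat) (a : R) (k j : nat) : (j + k)%nat = N ->
  exists M, 0 <= M /\ forall x, 0 <= x -> Rabs (altcos N a j x) <= M * x ^ k.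
Proof.
revert j; induction k as [|k IH]; intros j Hjk.
- destruct (altcos_bounded N a j) as [M HM]. exists M; split.
  + eapply Rle_trans; [apply Rabs_pos | apply (HM 0)].
  + intros x _. simpl. rewrite Rmult_1_r. apply HM.
- destruct (IH (S j) ltac:(lia)) as [M [HM0 HM]].
  exists M; split; [exact HM0|]; intros x Hx.
  rewrite <- (Rminus_0_r (altcos N a j x)), <- (altcos_at_0 N a j) by lia.
  replace (M * x ^ S k) with (M * x ^ k * Rabs (x - 0))
    by (rewrite Rminus_0_r, Rabs_pos_eq by exact Hx; simpl; ring).
  apply (Rabs_increment_le (altcos N a j) (altcos N a (S j))).
  intros y Hy. rewrite Rmin_left, Rmax_right in Hy by exact Hx.
  split; [apply is_derive_altcos|].
  eapply Rle_trans; [apply HM; lra|].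
  apply Rmult_le_compat_l; [exact HM0 | now apply pow_incr].
Qed.

(** * Repeated integration by parts *)

(** The bounds on [f] make the boundary term [f x / x ^ n] vanish like
    [x] at 0 and like [/ x] at infinity. *)
Lemma improper_by_parts (n : nat) (f df : R -> R) (l K : R) :
  (1 <= n)%nat ->
  (forall x, is_derive f x (df x)) ->
  (forall x, continuous df x) ->
  (forall x, Rabs (f x) <= K) ->
  (forall x, 0 < x <= 1 -> Rabs (f x) <= K * x ^ S n) ->
  is_improper_RInt_0_infty (fun x => df x / x ^ n) l ->
  is_improper_RInt_0_infty (fun x => f x / x ^ S n) (l / INR n).
Proof.
intros Hn Hd Hc Hb Hs Hl.
assert (HN : 1 <= INR n) by (apply (le_INR 1); exact Hn).
assert (HNi : 0 < / INR n <= 1).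
{ split; [apply Rinv_0_lt_compat; lra|]. rewrite <- Rinv_1.
  apply Rinv_le_contravar; lra. }
assert (Hx0 : forall x m, 0 < x -> 0 < x ^ m) by (intros; now apply pow_lt).
assert (HK : 0 <= K) by (eapply Rle_trans; [apply Rabs_pos | apply (Hb 0)]).
assert (Habs : forall x, 0 < x ->
  Rabs (- / INR n * (f x / x ^ n)) <= Rabs (f x) / x ^ n).
{ intros x Hx. unfold Rdiv.
  rewrite !Rabs_mult, Rabs_Ropp, (Rabs_pos_eq (/ INR n)) by lra.
  rewrite (Rabs_pos_eq (/ x ^ n)) by (left; apply Rinv_0_lt_compat; auto).
  rewrite <- (Rmult_1_l (Rabs (f x) * / x ^ n)) at 2.
  apply Rmult_le_compat_r; [|lra].
  apply Rmult_le_pos; [apply Rabs_pos | left; apply Rinv_0_lt_compat; auto]. }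
apply (improper_ext
  (fun x => (f x / x ^ S n - / INR n * (df x / x ^ n)) + / INR n * (df x / x ^ n))).
{ intros x Hx. ring. }
replace (l / INR n) with ((0 - 0) + / INR n * l) by (field; lra).
apply improper_plus; [|now apply improper_scal].
apply (improper_primitive (fun x => - / INR n * (f x / x ^ n))) with K.
- intros x Hx. specialize (Hd x).
  auto_derive.
  + split; [now exists (df x)|]. split; [|auto].
    exact (Rgt_not_eq _ _ (Hx0 x n Hx)).
  + replace (Derive (fun x => f x) x) with (df x)
      by (symmetry; exact (is_derive_unique f x _ Hd)).
    destruct n as [|n]; [lia|]. simpl pred. simpl pow.
    specialize (Hx0 x n Hx).
    field. lra.
- intros x Hx.
  apply (continuous_minus (fun x => f x / x ^ S n) (fun x => / INR n * (df x / x ^ n))).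
  + apply (ex_derive_continuous (fun x => f x / x ^ S n)).
    auto_derive. split; [now exists (df x)|]. split; [|auto].
    apply Rgt_not_eq. exact (Hx0 x (S n) Hx).
  + apply (continuous_mult (fun _ => / INR n)); [apply continuous_const|].
    apply (continuous_mult df (fun x => / x ^ n)); [apply Hc|].
    apply (ex_derive_continuous (fun x => / x ^ n)).
    auto_derive. exact (Rgt_not_eq _ _ (Hx0 x n Hx)).
- intros x Hx. rewrite Rminus_0_r.
  eapply Rle_trans; [apply Habs; lra|].
  apply Rle_div_l; [apply Hx0; lra|].
  eapply Rle_trans; [now apply Hs | simpl; lra].
- intros x Hx. rewrite Rminus_0_r.
  eapply Rle_trans; [apply Habs; lra|].
  apply Rmult_le_compat; [apply Rabs_pos | | apply Hb |].
  + left; apply Rinv_0_lt_compat, Hx0; lra.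
  + apply Rinv_le_contravar; [lra|].
    rewrite <- (pow_1 x) at 1. now apply Rle_pow.
Qed.

(** The condition [j + k + n <= N] keeps enough vanishing at 0 for each of the
    [k] boundary terms. *)
Lemma improper_altcos (N : nat) (a : R) (k n j : nat) (l : R) :
  (1 <= n)%nat -> (j + k + n <= N)%nat ->
  is_improper_RInt_0_infty (fun x => altcos N a (j + k) x / x ^ n) l ->
  is_improper_RInt_0_infty (fun x => altcos N a j x / x ^ (k + n))
    (l * INR (fact (n - 1)) / INR (fact (k + n - 1))).
Proof.
revert n l; induction k as [|k IH]; intros n l Hn HN Hl.
- rewrite Nat.add_0_r in Hl. simpl Nat.add.
  replace (l * INR (fact (n - 1)) / INR (fact (n - 1))) with l; [exact Hl|].
  field. apply INR_fact_neq_0.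
- assert (Hn0 : INR n <> 0) by (apply not_0_INR; lia).
  replace (l * INR (fact (n - 1)) / INR (fact (S k + n - 1)))
    with (l / INR n * INR (fact (S n - 1)) / INR (fact (k + S n - 1))).
  + replace (S k + n)%nat with (k + S n)%nat by lia.
    apply IH; [lia | lia |].
    destruct (altcos_bounded N a (j + k)) as [M1 H1].
    destruct (altcos_small N a (N - (j + k)) (j + k) ltac:(lia)) as [M2 [H20 H2]].
    assert (H10 : 0 <= M1) by (eapply Rle_trans; [apply Rabs_pos | apply (H1 0)]).
    apply (improper_by_parts n _ (altcos N a (S (j + k)))) with (M1 + M2).
    * exact Hn.
    * apply is_derive_altcos.
    * apply continuous_altcos.
    * intros x. specialize (H1 x). lra.
    * intros x Hx. eapply Rle_trans; [apply H2; lra|].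
      apply Rmult_le_compat; [exact H20 | apply pow_le; lra | lra |].
      replace (N - (j + k))%nat with (S n + (N - (j + k) - S n))%nat by lia.
      rewrite pow_add. rewrite <- (Rmult_1_r (x ^ S n)) at 2.
      apply Rmult_le_compat_l; [apply pow_le; lra|].
      rewrite <- (pow1 (N - (j + k) - S n)). apply pow_incr; lra.
    * now replace (S (j + k)) with (j + S k)%nat by lia.
  + replace (k + S n - 1)%nat with (S k + n - 1)%nat by lia.
    replace (S n - 1)%nat with (S (n - 1)) by lia.
    rewrite fact_simpl, mult_INR.
    replace (S (n - 1)) with n by lia.
    field. split; [apply INR_fact_neq_0 | exact Hn0].
Qed.

(** * The last integrals and the final value *)

Lemma altcos_even (N : nat) (a : R) (m : nat) (x : R) :
  altcos N a (2 * m) x =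
  (-1) ^ m * alt_sum N (fun i => (INR i - a) ^ (2 * m) * cos ((INR i - a) * x)).
Proof.
rewrite <- alt_sum_scal. apply alt_sum_ext; intros i.
rewrite mult_INR. simpl (INR 2).
replace ((1 + 1) * INR m * (PI / 2)) with (INR m * PI) by field.
assert (H : forall y, cos (y + INR m * PI) = (-1) ^ m * cos y).
{ intros y. induction m as [|m IH].
  - simpl. rewrite Rmult_0_l, Rplus_0_r. ring.
  - rewrite S_INR.
    replace (y + (INR m + 1) * PI) with (y + INR m * PI + PI) by ring.
    rewrite neg_cos, IH. simpl; ring. }
rewrite H. ring.
Qed.

(** Since the alternating sum of the [2 * m]-th powers is 0, each cosine may be
    replaced by the cosine minus 1, whose integral converges separately. *)
Lemma improper_altcos_even (N : nat) (a : R) (m : nat) : (2 * m < N)%nat ->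
  is_improper_RInt_0_infty (fun x => altcos N a (2 * m) x / x ^ 2)
    (- (-1) ^ m * alt_sum N (fun i => (INR i - a) ^ (2 * m) * (Rabs (INR i - a) * (PI / 2)))).
Proof.
intros Hm.
apply (improper_ext (fun x => - (-1) ^ m *
  alt_sum N (fun i => (INR i - a) ^ (2 * m) * ((1 - cos ((INR i - a) * x)) / x ^ 2)))).
- intros x Hx. rewrite altcos_even.
  rewrite (alt_sum_ext _ (fun i => _ * (_ / x ^ 2))
    (fun i => / x ^ 2 * ((INR i - a) ^ (2 * m)
              - (INR i - a) ^ (2 * m) * cos ((INR i - a) * x)))).
  + rewrite alt_sum_scal, alt_sum_minus, alt_sum_pow_eq_0 by exact Hm. field. lra.
  + intros i. field. lra.
- apply improper_scal.
  apply (alt_sum_improper N (fun i x => (INR i - a) ^ (2 * m)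
            * ((1 - cos ((INR i - a) * x)) / x ^ 2))).
  intros i. apply improper_scal, improper_one_minus_cos.
Qed.

(** The same vanishing sum allows subtracting [cos (b * x)] from every cosine.
    The term with [INR i = a] has a zero coefficient as [m >= 1], so the
    meaningless logarithm there is harmless. *)
Lemma improper_altcos_odd (N : nat) (a b : R) (m : nat) :
  (1 <= m)%nat -> (2 * m < N)%nat -> 0 < b ->
  is_improper_RInt_0_infty (fun x => altcos N a (2 * m) x / x ^ 1)
    ((-1) ^ m * alt_sum N (fun i => (INR i - a) ^ (2 * m) * ln (b / Rabs (INR i - a)))).
Proof.
intros Hm HmN Hb.
apply (improper_ext (fun x => (-1) ^ m *
  alt_sum N (fun i => (INR i - a) ^ (2 * m)
                  * ((cos (Rabs (INR i - a) * x) - cos (b * x)) / x)))).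
- intros x Hx. rewrite altcos_even.
  rewrite (alt_sum_ext _ (fun i => _ * (_ / x))
    (fun i => / x * ((INR i - a) ^ (2 * m) * cos ((INR i - a) * x)
              - cos (b * x) * (INR i - a) ^ (2 * m)))).
  + rewrite alt_sum_scal, alt_sum_minus, alt_sum_scal, alt_sum_pow_eq_0 by exact HmN.
    field. lra.
  + intros i. rewrite cos_Rabs_mul. field. lra.
- apply improper_scal.
  apply (alt_sum_improper N (fun i x => (INR i - a) ^ (2 * m)
            * ((cos (Rabs (INR i - a) * x) - cos (b * x)) / x))).
  intros i. destruct (Req_dec (INR i - a) 0) as [E|E].
  + rewrite E, pow_i, Rmult_0_l by lia.
    apply (improper_ext (fun _ => 0)); [intros; ring | exact improper_zero].
  + apply improper_scal, improper_frullani_cos; [now apply Rabs_pos_lt | exact Hb].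
Qed.

Lemma one_minus_cos_pow_altcos (p : nat) (x : R) :
  (1 - cos x) ^ p = (- / 2) ^ p * altcos (2 * p) (INR p) 0 x.
Proof.
rewrite one_minus_cos_pow. f_equal. apply alt_sum_ext; intros i.
rewrite Rmult_0_l, Rplus_0_r. simpl; ring.
Qed.

Lemma pow_even_opp (m : nat) (x : R) : (- x) ^ (2 * m) = x ^ (2 * m).
Proof. rewrite !pow_mult. f_equal. ring. Qed.

Lemma improper_even_case (p m : nat) : (m < p)%nat ->
  is_improper_RInt_0_infty (fun x => (1 - cos x) ^ p / x ^ (2 * m + 2))
    (PI * (-1) ^ S m / (2 ^ p * INR (fact (2 * m + 1)))
     * sum_n_m (fun k => (-1) ^ k * binom (2 * p) (p - k) * INR k ^ (2 * m + 1)) 1 p).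
Proof.
intros Hm.
pose proof (improper_altcos (2 * p) (INR p) (2 * m) 2 0 _ ltac:(lia) ltac:(lia)
  (improper_altcos_even (2 * p) (INR p) m ltac:(lia))) as H.
apply (improper_scal _ ((- / 2) ^ p)) in H.
apply (improper_ext _ (fun x => (1 - cos x) ^ p / x ^ (2 * m + 2))) in H.
2:{ intros x Hx. rewrite one_minus_cos_pow_altcos. unfold Rdiv; ring. }
refine (improper_eq _ _ _ _ H).
rewrite (alt_sum_even_fold p (fun y => y ^ (2 * m) * (Rabs y * (PI / 2)))).
2:{ rewrite Rabs_R0; ring. }
2:{ intros y. rewrite Rabs_Ropp, pow_even_opp. reflexivity. }
set (s := sum_n_m _ 1 p) at 1.
set (s' := sum_n_m _ 1 p).
assert (E : s = PI / 2 * s').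
{ unfold s, s'. rewrite <- (sum_n_m_mult_l (K := R_Ring)).
  apply sum_n_m_ext; intros k. unfold mult; simpl mult.
  rewrite Rabs_pos_eq by apply pos_INR.
  rewrite (pow_add (INR k) (2 * m) 1). simpl; ring. }
rewrite E.
replace (2 * m + 2 - 1)%nat with (2 * m + 1)%nat by lia.
assert (E2 : (- / 2) ^ p * (-1) ^ p = / 2 ^ p).
{ rewrite <- Rpow_mult_distr, <- pow_inv. f_equal. field. }
pose proof (INR_fact_neq_0 (2 * m + 1)).
assert (2 ^ p <> 0) by (apply pow_nonzero; lra).
transitivity ((- / 2) ^ p * (-1) ^ p * (PI * (-1) ^ S m * s' / INR (fact (2 * m + 1)))).
- simpl pow; simpl (fact (2 - 1)); simpl (INR 1). field. assumption.
- rewrite E2. field. split; assumption.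
Qed.

(** Taking [p] as reference frequency in [improper_altcos_odd] makes the
    logarithm at [k = p] vanish, so the sum stops at [p - 1]. *)
Lemma improper_odd_case (p m : nat) : (1 <= m)%nat -> (m < p)%nat ->
  is_improper_RInt_0_infty (fun x => (1 - cos x) ^ p / x ^ (2 * m + 1))
    ((-1) ^ m / (2 ^ (p - 1) * INR (fact (2 * m)))
     * sum_n_m (fun k => (-1) ^ k * binom (2 * p) (p - k) * INR k ^ (2 * m)
                         * ln (INR p / INR k)) 1 (p - 1)).
Proof.
intros Hm Hmp.
assert (Hp : 0 < INR p) by (apply lt_0_INR; lia).
pose proof (improper_altcos (2 * p) (INR p) (2 * m) 1 0 _ ltac:(lia) ltac:(lia)
  (improper_altcos_odd (2 * p) (INR p) (INR p) m Hm ltac:(lia) Hp)) as H.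
apply (improper_scal _ ((- / 2) ^ p)) in H.
apply (improper_ext _ (fun x => (1 - cos x) ^ p / x ^ (2 * m + 1))) in H.
2:{ intros x Hx. rewrite one_minus_cos_pow_altcos. unfold Rdiv; ring. }
refine (improper_eq _ _ _ _ H).
rewrite (alt_sum_even_fold p (fun y => y ^ (2 * m) * ln (INR p / Rabs y))).
2:{ rewrite pow_i by lia. ring. }
2:{ intros y. rewrite Rabs_Ropp, pow_even_opp. reflexivity. }
set (s := sum_n_m _ 1 p).
set (s' := sum_n_m _ 1 (p - 1)).
assert (E : s = s').
{ unfold s, s'. clear - Hp. destruct p as [|r]; [simpl in Hp; lra|].
  replace (S r - 1)%nat with r by lia. rewrite sum_n_Sm by lia.
  rewrite Rabs_pos_eq, Rdiv_diag, ln_1, !Rmult_0_r by lra.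
  unfold plus; simpl plus. rewrite Rplus_0_r.
  apply sum_n_m_ext; intros k.
  rewrite Rabs_pos_eq by apply pos_INR. now rewrite !Rmult_assoc. }
rewrite E.
replace (2 * m + 1 - 1)%nat with (2 * m)%nat by lia.
assert (E2 : (- / 2) ^ p * (-1) ^ p = / (2 * 2 ^ (p - 1))).
{ rewrite <- Rpow_mult_distr. change (2 * 2 ^ (p - 1)) with (2 ^ S (p - 1)).
  replace (S (p - 1)) with p by lia.
  rewrite <- pow_inv. f_equal. field. }
pose proof (INR_fact_neq_0 (2 * m)).
assert (2 ^ (p - 1) <> 0) by (apply pow_nonzero; lra).
unfold plus; simpl plus.
transitivity ((- / 2) ^ p * (-1) ^ p * (2 * (-1) ^ m * s' / INR (fact (2 * m)))).
- simpl (fact (1 - 1)); simpl (INR 1). field. assumption.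
- rewrite E2. field. split; assumption.
Qed.

Lemma improper_scale_beta (p q : nat) (beta l : R) :
  (1 <= p)%nat -> (2 <= q)%nat ->
  is_improper_RInt_0_infty (fun x => (1 - cos x) ^ p / x ^ q) l ->
  is_improper_RInt_0_infty (fun x => (1 - cos (beta * x)) ^ p / x ^ q)
    (Rabs beta ^ (q - 1) * l).
Proof.
intros Hp Hq Hl.
destruct (Req_dec beta 0) as [->|Hb].
- rewrite Rabs_R0, pow_i, Rmult_0_l by lia.
  apply (improper_ext (fun _ => 0)); [|exact improper_zero].
  intros x Hx. rewrite Rmult_0_l, cos_0, Rminus_diag_eq, pow_i by (reflexivity || lia).
  unfold Rdiv; ring.
- pose proof (Rabs_pos_lt beta Hb) as Hb0.
  apply (improper_comp_scale _ (Rabs beta)) in Hl; [|exact Hb0].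
  apply (improper_scal _ (Rabs beta ^ (q - 1))) in Hl.
  revert Hl. apply improper_ext. intros x Hx.
  replace (cos (Rabs beta * x)) with (cos (beta * x)).
  + replace q with (S (q - 1)) at 2 3 by lia.
    rewrite Rpow_mult_distr. simpl pow.
    pose proof (pow_lt x (q - 1) Hx). pose proof (pow_lt _ (q - 1) Hb0).
    field. lra.
  + symmetry. apply cos_Rabs_mul.
Qed.

Theorem corollary5p4 (p q : nat) (hp : (1 <= p)%nat)
    (hq : (2 <= q)%nat) (hqp : (q <= 2 * p)%nat) (beta : R) :
  (Nat.Even q ->
     is_improper_RInt_0_infty
       (fun x : R => (1 - cos (beta * x)) ^ p / x ^ q)
       (PI * (-1) ^ (q / 2) * Rabs beta ^ (q - 1)
          / (2 ^ p * INR (fact (q - 1)))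
        * sum_n_m (fun k : nat =>
            (-1) ^ k * binom (2 * p) (p - k) * INR k ^ (q - 1)) 1 p))
  /\
  (Nat.Odd q ->
     is_improper_RInt_0_infty
       (fun x : R => (1 - cos (beta * x)) ^ p / x ^ q)
       ((-1) ^ ((q - 1) / 2) * Rabs beta ^ (q - 1)
          / (2 ^ (p - 1) * INR (fact (q - 1)))
        * sum_n_m (fun k : nat =>
            (-1) ^ k * binom (2 * p) (p - k) * INR k ^ (q - 1)
              * ln (INR p / INR k)) 1 (p - 1))).
Proof.
split; intros [m Hm].
- destruct m as [|m]; [lia|].
  assert (E : q = (2 * m + 2)%nat) by lia. clear Hm. subst q.
  pose proof (improper_scale_beta _ _ beta _ hp hq (improper_even_case p m ltac:(lia))) as H.
  replace ((2 * m + 2) / 2)%nat with (S m)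
    by (replace (2 * m + 2)%nat with (S m * 2)%nat by lia; now rewrite Nat.div_mul).
  replace (2 * m + 2 - 1)%nat with (2 * m + 1)%nat in * by lia.
  refine (improper_eq _ _ _ _ H).
  unfold Rdiv; ring.
- subst q.
  pose proof (improper_scale_beta _ _ beta _ hp hq
    (improper_odd_case p m ltac:(lia) ltac:(lia))) as H.
  replace (2 * m + 1 - 1)%nat with (2 * m)%nat in * by lia.
  replace (2 * m / 2)%nat with m
    by (rewrite Nat.mul_comm; now rewrite Nat.div_mul).
  refine (improper_eq _ _ _ _ H).
  unfold Rdiv; ring.
Qed.
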